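(* Let $M$ be a weakly communicating MDP and $\varepsilon,\delta\in(0,1)$. Consider any sampling rule (in the generative model or online setting) producing state–action pairs $(s_n,a_n)_{n\ge1}$ and observed next states, and any (possibly data-dependent) sequence of vectors $(b_n)_{n\ge0}$ in $\mathbb{R}^S$. Let \[\tau=\min\Big\{n:\ \max_s\max_aI^{n,\sharp}_{s,a}-\min_s\max_aI^{n,\flat}_{s,a}\le\varepsilon\Big\},\] where $I^{n,\sharp}_{s,a}=\bar r_{s,a}+U^n_{s,a}-b_n(s)$, $I^{n,\flat}_{s,a}=\bar r_{s,a}+L^n_{s,a}-b_n(s)$, and \[U^n_{s,a}=\max\{q\,b_n:\ q\in\Sigma_S,\ N^n_{s,a}\mathrm{KL}(\hat p^n_{s,a},q)\le x(\delta,N^n_{s,a})\},\quad L^n_{s,a}=\min\{q\,b_n:\ q\in\Sigma_S,\ N^n_{s,a}\mathrm{KL}(\hat p^n_{s,a},q)\le x(\delta,N^n_{s,a})\}.\] Let $\hat\pi(s)\in\arg\max_aI^{\tau,\flat}_{s,a}$. Then $\mathbb{P}(\tau<\infty,\ \exists s:\ g^\star-g_{\hat\pi}(s)>\varepsilon)\le\delta$. The same conclusion holds if $U^n_{s,a},L^n_{s,a}$ are replaced by $\tilde U^n_{s,a}=\hat p^n_{s,a}b_n+\|b_n\|_\infty\sqrt{2x(\delta,N^n_{s,a})/N^n_{s,a}}$ and $\tilde L^n_{s,a}=\hat p^n_{s,a}b_n-\|b_n\|_\infty\sqrt{2x(\delta,N^n_{s,a})/N^n_{s,a}}$.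
   Context: MDP: finite states ($S$ of them), finite actions ($A$ of them), transitions $p_{s,a}$, known mean rewards $\bar r_{s,a}\in[0,1]$. Weakly communicating: there is a closed set of states each reachable from every other under some stationary deterministic policy, the rest being transient under every policy; then the optimal gain $g^\star$ is a constant, where $g_\pi(s)=\lim_T\frac1T\mathbb{E}_\pi[\sum_{t<T}r_t\mid s_0=s]$. $\Sigma_S$ is the probability simplex on the states. $N^n_{s,a}=\sum_{t=1}^n\mathbb{1}\{(s_t,a_t)=(s,a)\}$ is the number of observed transitions from $(s,a)$ among the first $n$ samples, $\hat p^n_{s,a}$ is the empirical distribution of the corresponding next states (set to the uniform vector if $N^n_{s,a}=0$). $\mathrm{KL}$ is the Kullback–Leibler divergence between distributions on the states. The threshold is $x(\delta,y)=\log(SA/\delta)+(S-1)\log\big(e(1+y/(S-1))\big)$. When $N^n_{s,a}=0$ the constraint in $U,L$ is vacuous (and the relaxed radius is $+\infty$). *)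

(* Defs.v *)
From HB Require Import structures.
From mathcomp Require Import all_boot all_order all_algebra.
From mathcomp Require Import all_classical all_reals all_analysis.
Set Implicit Arguments. Unset Strict Implicit. Unset Printing Implicit Defensive.
Import Order.TTheory GRing.Theory Num.Theory.
Import numFieldNormedType.Exports.
Local Open Scope classical_set_scope.
Local Open Scope ring_scope.

Section MDP.
Variables (R : realType) (St Act : finType).

Definition mdp_kernel (p : St -> Act -> St -> R) :=
  forall s a, (forall s', 0 <= p s a s') /\ \sum_(s' : St) p s a s' = 1.

Definition policy := St -> Act.

Definition step (p : St -> Act -> St -> R) (pi : policy) (v : St -> R) : St -> R :=
  fun x => \sum_(z : St) p x (pi x) z * v z.

Definition ptrans (p : St -> Act -> St -> R) (pi : policy) (n : nat) (s s' : St) : R :=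
  iter n (step p pi) (fun z => if z == s' then 1 else 0) s.

(** probability, starting from x, of NOT visiting s at times 1..n under pi *)
Definition avoid (p : St -> Act -> St -> R) (pi : policy) (s : St) (n : nat) : St -> R :=
  iter n (fun w x => \sum_(z : St) p x (pi x) z * (if z == s then 0 else w z))
    (fun _ => 1).

Definition return_within (p : St -> Act -> St -> R) (pi : policy) (s : St) (n : nat) : R := 1 - avoid p pi s n s.

(** s is transient for the chain P_pi: the probability of ever returning
    (the increasing limit of return_within) is < 1 *)
Definition transient (p : St -> Act -> St -> R) (pi : policy) (s : St) :=
  exists c : R, c < 1 /\ forall n, return_within p pi s n <= c.

(** weakly communicating (Puterman, Sec. 8.3.1) *)
Definition weakly_communicating (p : St -> Act -> St -> R) :=
  exists C : {set St}, C != finset.set0 /\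
    (forall s a s', s \in C -> 0 < p s a s' -> s' \in C) /\
    (forall s s', s \in C -> s' \in C ->
        exists (pi : policy) (n : nat), 0 < ptrans p pi n s s') /\
    (forall s, s \notin C -> forall pi : policy, transient p pi s).

Definition exp_reward p (rbar : St -> Act -> R) (pi : policy) (t : nat) : St -> R :=
  iter t (step p pi) (fun x => rbar x (pi x)).

Definition gain (p : St -> Act -> St -> R) (rbar : St -> Act -> R) (pi : policy) (s : St) : R :=
  limn (fun T : nat => (T%:R^-1 * \sum_(t < T) exp_reward p rbar pi t s : R)).

Definition optgain (p : St -> Act -> St -> R) (rbar : St -> Act -> R) (s : St) : R :=
  sup [set gain p rbar pi s | pi in [set: policy]].

(** simplex and KL divergence (with 0 log 0 = 0, and +oo if not abs. cont.) *)
Definition simplex (q : St -> R) :=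
  (forall s, 0 <= q s) /\ \sum_(s : St) q s = 1.

Definition KL (p q : St -> R) : \bar R :=
  if [forall s, (0 < p s) ==> (0 < q s)] then
    (\sum_(s : St | 0 < p s) p s * ln (p s / q s))%:E
  else +oo%E.

Definition xthr (delta y : R) : R :=
  let S := #|St|%:R in let A := #|Act|%:R in
  ln (S * A / delta) + (S - 1) * ln (expR 1 * (1 + y / (S - 1))).

Definition dotp (q b : St -> R) : R := \sum_(s : St) q s * b s.

Definition supnorm (b : St -> R) : R := \big[Num.max/0]_(s : St) `|b s|.

Definition KLball (delta : R) (ph : St -> R) (N : nat) (q : St -> R) :=
  simplex q /\
  (N = 0%N \/ ((N%:R)%:E * KL ph q <= (xthr delta N%:R)%:E)%E).

Definition Ukl (delta : R) (ph : St -> R) (N : nat) (b : St -> R) : \bar R :=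
  (sup [set dotp q b | q in KLball delta ph N])%:E.
Definition Lkl (delta : R) (ph : St -> R) (N : nat) (b : St -> R) : \bar R :=
  (inf [set dotp q b | q in KLball delta ph N])%:E.

Definition Utl (delta : R) (ph : St -> R) (N : nat) (b : St -> R) : \bar R :=
  if N == 0%N then +oo%E
  else (dotp ph b + supnorm b * Num.sqrt (2 * xthr delta N%:R / N%:R))%:E.
Definition Ltl (delta : R) (ph : St -> R) (N : nat) (b : St -> R) : \bar R :=
  if N == 0%N then -oo%E
  else (dotp ph b - supnorm b * Num.sqrt (2 * xthr delta N%:R / N%:R))%:E.

End MDP.

Section Sampling.
Variables (R : realType) (St Act : finType) (d : measure_display)
  (T : measurableType d).

(** Sampling rule: (s_n, a_n) = sa n, observed next state y n.
    F n = information available once (s_n, a_n) has been chosen (history,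
    internal randomisation); conditionally on F n the next state y n has law
    p_{s_n, a_n}. *)
Definition sampling_rule (P : probability T R) (F : nat -> set (set T))
  (p : St -> Act -> St -> R) (sa : nat -> T -> St * Act) (y : nat -> T -> St) :=
  (forall n, sigma_algebra setT (F n)) /\
  (forall n, F n `<=` measurable) /\
  (forall n, F n `<=` F n.+1) /\
  (forall n x, F n [set w | sa n w = x]) /\
  (forall n z, F n.+1 [set w | y n w = z]) /\
  (forall n H s a z, F n H ->
     P (H `&` [set w | sa n w = (s, a)] `&` [set w | y n w = z]) =
     ((p s a z)%:E * P (H `&` [set w | sa n w = (s, a)]))%E).

Definition Ncount (sa : nat -> T -> St * Act) (n : nat) (w : T) (s : St) (a : Act) : nat :=
  \sum_(t < n) (sa t w == (s, a)).

Definition phat (sa : nat -> T -> St * Act) (y : nat -> T -> St) (n : nat) (w : T) (s : St) (a : Act)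
  : St -> R :=
  fun z => if Ncount sa n w s a == 0%N then #|St|%:R^-1
    else (\sum_(t < n) ((sa t w == (s, a)) && (y t w == z)))%:R
         / (Ncount sa n w s a)%:R.

Definition bound_fun := R -> (St -> R) -> nat -> (St -> R) -> \bar R.

Section Index.
Variables (Ub Lb : bound_fun) (delta eps : R) (rbar : St -> Act -> R)
  (sa : nat -> T -> St * Act) (y : nat -> T -> St) (b : nat -> T -> St -> R).

Definition Isharp (n : nat) (w : T) (s : St) (a : Act) : \bar R :=
  ((rbar s a)%:E + Ub delta (phat sa y n w s a) (Ncount sa n w s a) (b n w)
   - (b n w s)%:E)%E.
Definition Iflat (n : nat) (w : T) (s : St) (a : Act) : \bar R :=
  ((rbar s a)%:E + Lb delta (phat sa y n w s a) (Ncount sa n w s a) (b n w)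
   - (b n w s)%:E)%E.

Definition stop_cond (n : nat) (w : T) : Prop :=
  ((\big[maxe/-oo%E]_(s : St) \big[maxe/-oo%E]_(a : Act) Isharp n w s a)
   - (\big[mine/+oo%E]_(s : St) \big[maxe/-oo%E]_(a : Act) Iflat n w s a)
   <= eps%:E)%E.

Definition is_tau (w : T) (n : nat) := stop_cond n w /\ forall m, (m < n)%N -> ~ stop_cond m w.

Definition greedy_at_tau (pihat : T -> St -> Act) :=
  forall w n, is_tau w n -> forall s a, (Iflat n w s a <= Iflat n w s (pihat w s))%E.

Definition bad_event (p : St -> Act -> St -> R) (pihat : T -> St -> Act) : set T :=
  [set w | (exists n, is_tau w n) /\
     exists s, eps < optgain p rbar s - gain p rbar (pihat w) s].
End Index.

(** P(E) <= c, in outer-measure form (E need not be shown measurable) *)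
Definition prob_le (P : probability T R) (E : set T) (c : R) :=
  exists B, measurable B /\ E `<=` B /\ (P B <= c%:E)%E.

End Sampling.

(* Main.v *)
(** On the event that every true law [p s a] lies in its confidence ball at all times,
    [U] and [L] bracket [p s a . b], so that the stopping rule yields
    [r(s,a) + p_{s,a} b - b(s) <= r(s',pihat s') + p_{s',pihat s'} b - b(s') + eps]
    for all [s], [a], [s'].  The gain of any stationary policy [pi] lies between the extreme
    values of [r_pi + P_pi b - b], whatever [b] is, hence the claim; no optimality equation
    is involved.  For the probability of the event, the likelihood ratio of the uniform
    (Laplace) mixture to [p s a] is a supermartingale along the visits to [(s, a)]; Ville's
    inequality bounds it by [S A / delta] simultaneously over time, and its logarithm is at
    least [N KL(phat, p)] minus [ln 'C(N + S - 1, S - 1)].  Pinsker's inequality shows that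
    the relaxed bounds contain the KL ones. *)

Require Import Defs.
From HB Require Import structures.
From mathcomp Require Import all_boot all_order all_algebra.
From mathcomp Require Import all_classical all_reals all_analysis.
From mathcomp Require Import ring lra.
Import Order.TTheory GRing.Theory Num.Theory.
Import numFieldNormedType.Exports.
Local Open Scope classical_set_scope.
Local Open Scope ring_scope.

(** * Cesàro averages of a Markov operator on a finite state space *)

Section MarkovOperator.
Context {R : realType} {St : finType} (Q : St -> St -> R).
Hypothesis Q_ge0 : forall x z, 0 <= Q x z.
Hypothesis Q_sum1 : forall x, \sum_(z : St) Q x z = 1.

(** Functions on the states form a finite-dimensional vector space in this encoding, so that
    kernels, images and dimensions make sense. *)
Let V := {ffun St -> R^o}.

Definition markov_op (v : V) : V := [ffun x => \sum_(z : St) Q x z * v z].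

Lemma markov_op_linear : linear markov_op.
Proof.
move=> a u v; apply/ffunP => x; rewrite !ffunE [in RHS]/GRing.scale /=.
rewrite mulr_sumr -big_split /=; apply: eq_bigr => z _.
by rewrite !ffunE [in LHS]/GRing.scale /= mulrDr mulrCA.
Qed.

HB.instance Definition _ :=
  GRing.isLinear.Build R V V *:%R markov_op markov_op_linear.

Lemma iter_markov_opB t u v :
  iter t markov_op (u - v) = iter t markov_op u - iter t markov_op v.
Proof. by elim: t => //= t ->; rewrite linearB. Qed.

Lemma iter_markov_opD t u v :
  iter t markov_op (u + v) = iter t markov_op u + iter t markov_op v.
Proof. by elim: t => //= t ->; rewrite linearD. Qed.

Lemma iter_markov_opN t u : iter t markov_op (- u) = - iter t markov_op u.
Proof. by elim: t => //= t ->; rewrite linearN. Qed.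

Lemma iter_markov_op_le t (u : V) (G : R) :
  (forall x, u x <= G) -> forall x, iter t markov_op u x <= G.
Proof.
elim: t => //= t IH uG x; rewrite ffunE -[leRHS]mul1r -(Q_sum1 x) mulr_suml.
by apply: ler_sum => z _; rewrite ler_wpM2l ?IH.
Qed.

Lemma iter_markov_op_ge t (u : V) (G : R) :
  (forall x, G <= u x) -> forall x, G <= iter t markov_op u x.
Proof.
elim: t => //= t IH uG x; rewrite ffunE -[leLHS]mul1r -(Q_sum1 x) mulr_suml.
by apply: ler_sum => z _; rewrite ler_wpM2l ?IH.
Qed.

Lemma iter_markov_op_bounded (u : V) : exists K : R, forall t x, `|iter t markov_op u x| <= K.
Proof.
exists (\sum_z `|u z|) => t x.
have h z : `|u z| <= \sum_z `|u z|.
  by rewrite (bigD1 z) //= lerDl sumr_ge0.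
rewrite ler_norml iter_markov_op_ge ?iter_markov_op_le // => z.
- by rewrite (le_trans _ (h z)) // ler_norm.
- by rewrite lerNl (le_trans _ (h z)) // -normrN ler_norm.
Qed.

(** The sum telescopes. *)
Lemma sum_iter_coboundary T (w : V) :
  \sum_(t < T) iter t markov_op (w - markov_op w) = w - iter T markov_op w.
Proof.
elim: T => [|T IH]; first by rewrite big_ord0 /= subrr.
by rewrite big_ord_recr /= IH iter_markov_opB -iterSr /= addrA subrK.
Qed.

Definition coboundary : 'End(V) := linfun (fun v : V => v - markov_op v).

Lemma coboundaryE v : coboundary v = v - markov_op v.
Proof.
have lin : linear (fun v : V => v - markov_op v).
  by move=> a u w; rewrite linearP scalerBr opprD addrACA.
pose m := GRing.isLinear.Build R V V *:%R _ lin.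
pose f : {linear V -> V} := HB.pack (fun v : V => v - markov_op v) m.
by rewrite /coboundary (lfunE f).
Qed.

(** Summing [T] iterates of [v] gives [v *+ T] by invariance and [w - iter T markov_op w] by
    telescoping; the latter stays bounded in [T], which forces [v] to vanish. *)
Lemma invariant_coboundary_eq0 (v w : V) :
  markov_op v = v -> v = w - markov_op w -> v = 0.
Proof.
move=> vP vw; apply/ffunP => x; rewrite [RHS]ffunE; apply/eqP; apply/negPn/negP => v0.
have [K hK] := iter_markov_op_bounded w.
have vT T : v *+ T = w - iter T markov_op w.
  rewrite -sum_iter_coboundary -vw -[in LHS](card_ord T) -sumr_const.
  by apply: eq_bigr => t _; elim: (t : nat) => //= n <-.
have : forall T, `|v x| *+ T <= K *+ 2.
  move=> T; rewrite -normrMn.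
  have -> : v x *+ T = (v *+ T) x by rewrite ffunMnE.
  rewrite vT !ffunE mulr2n (le_trans (ler_normB _ _)) //.
  by rewrite lerD // (hK 0%N).
have v0' : 0 < `|v x| by rewrite normr_gt0.
(* This [T] exceeds [K *+ 2 / |v x|], so [T] copies of [|v x|] pass the bound. *)
move=> /(_ (Num.truncn (K *+ 2 / `|v x|)).+1).
rewrite -[leLHS]mulr_natr mulrC -ler_pdivlMr // leNgt => /negP; apply.
exact: truncnS_gt.
Qed.

(* The kernel and the image of [1 - Q] meet trivially, so they span the whole space
   by rank-nullity: this replaces the ergodic theorem. *)
Lemma invariant_coboundary_decomposition (r : V) :
  exists u w : V, markov_op u = u /\ r = u + (w - markov_op w).
Proof.
have cap0 : (lker coboundary :&: limg coboundary = 0)%VS.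
  apply/eqP; rewrite -subv0; apply/subvP => v.
  rewrite memv_cap memv_ker coboundaryE subr_eq0 => /andP[/eqP vP].
  case/memv_imgP => w _; rewrite coboundaryE => vw.
  by rewrite memv0 (invariant_coboundary_eq0 v w).
have full : (lker coboundary + limg coboundary = fullv)%VS.
  apply/eqP; rewrite eqEdim subvf /= dimv_disjoint_sum //.
  by rewrite -(limg_ker_dim coboundary fullv) capfv.
have : r \in fullv by rewrite memvf.
rewrite -full => /memv_addP[u]; rewrite memv_ker coboundaryE subr_eq0 => /eqP uP.
case=> _ /memv_imgP[w _ ->]; rewrite coboundaryE => ->.
by exists u, w.
Qed.

Lemma cesaro_bounded_cvg (f : nat -> R) (u K : R) :
  (forall T, `|f T| <= K) ->
  (fun T : nat => T%:R^-1 * (u *+ T + f T)) @ \oo --> u.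
Proof.
(* The shift by one avoids the average at [T = 0] and turns [T%:R^-1] into [harmonic]. *)
move=> fK; rewrite -cvg_shiftS /=.
rewrite [X in X @ \oo](_ : _ = (fun n => u + harmonic n * f n.+1)); last first.
  apply/funext => n /=; rewrite mulrDr; congr (_ + _).
  by rewrite -[X in _ * X]mulr_natl mulrA mulVf ?mul1r // pnatr_eq0.
suff: (fun n => u + harmonic n * f n.+1) @ \oo --> u + 0 by rewrite addr0.
apply: cvgD; first exact: cvg_cst.
apply/norm_cvg0P; apply: (@squeeze_cvgr _ _ _ _ (cst 0) (fun n => harmonic n * K)).
- apply: nearW => n /=; rewrite normr_ge0 normrM ger0_norm ?invr_ge0 //=.
  by rewrite ler_wpM2l ?invr_ge0.
- exact: cvg_cst.
- by rewrite -(mul0r K); apply: cvgMl; exact: cvg_harmonic.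
Qed.

(** Averages of the invariant part of [r] are constant, and those of the coboundary part telescope
    to a bounded quantity divided by [T]. *)
Lemma cesaro_cvg (r : V) x :
  cvgn (fun T : nat => T%:R^-1 * (\sum_(t < T) iter t markov_op r x : R)).
Proof.
have [u [w [uP ->]]] := invariant_coboundary_decomposition r.
have [K hK] := iter_markov_op_bounded w.
apply/cvg_ex; exists (u x).
have -> : (fun T : nat => T%:R^-1 *
    (\sum_(t < T) iter t markov_op (u + (w - markov_op w)) x : R)) =
    (fun T : nat => T%:R^-1 * (u x *+ T + (w x - iter T markov_op w x))).
  apply/funext => T; congr (_ * _).
  have := congr1 (fun v : V => v x) (sum_iter_coboundary T w).
  rewrite sum_ffunE /= !ffunE => <-.
  rewrite -[X in u x *+ X](card_ord T) -sumr_const -big_split /=.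
  apply: eq_bigr => t _.
  rewrite iter_markov_opD ffunE; congr (_ + _).
  by have -> : iter t markov_op u = u by elim: (nat_of_ord t) => //= n ->.
apply: (@cesaro_bounded_cvg _ _ (K *+ 2)) => T.
by rewrite mulr2n (le_trans (ler_normB _ _)) // lerD // (hK 0%N).
Qed.

(** The hypothesis reads [r <= G + (b - markov_op b)]. A Markov operator is monotone and fixes
    constants, so the iterates preserve this inequality, and the coboundaries telescope to at most
    [K *+ 2]. *)
Lemma sum_iter_le T (r b : V) (G K : R) x :
  (forall t x, `|iter t markov_op b x| <= K) ->
  (forall x, r x + markov_op b x - b x <= G) ->
  \sum_(t < T) iter t markov_op r x <= G *+ T + K *+ 2.
Proof.
move=> hK hG.
have h t : iter t markov_op r x <= G + iter t markov_op (b - markov_op b) x.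
  rewrite -lerBlDr.
  have -> : iter t markov_op r x - iter t markov_op (b - markov_op b) x =
      iter t markov_op (r - (b - markov_op b)) x.
    by rewrite (iter_markov_opB t r) [RHS]ffunE; congr (_ + _); rewrite ffunE.
  apply: iter_markov_op_le => z; apply: le_trans (hG z).
  by rewrite opprB addrA !ffunE.
apply: le_trans; first by apply: ler_sum => t _; exact: h.
rewrite big_split /= sumr_const card_ord lerD2l.
have := congr1 (fun v : V => v x) (sum_iter_coboundary T b).
rewrite sum_ffunE /= !ffunE => ->.
rewrite mulr2n; apply: le_trans (ler_norm _) _.
by rewrite (le_trans (ler_normB _ _)) // lerD // (hK 0%N).
Qed.

Lemma cesaro_le (r b : V) (G : R) x :
  (forall x, r x + markov_op b x - b x <= G) ->
  limn (fun T : nat => T%:R^-1 * (\sum_(t < T) iter t markov_op r x : R)) <= G.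
Proof.
move=> hG; have [K hK] := iter_markov_op_bounded b.
(* The excess [K *+ 2] does not depend on [T], so it disappears in the average. *)
have c := @cesaro_bounded_cvg (fun=> K *+ 2) G `|K *+ 2| (fun _ => lexx _).
rewrite -(cvg_lim _ c) //; apply: ler_lim => //.
- exact: cesaro_cvg.
- by apply/cvg_ex; exists G.
- apply: nearW => T; rewrite ler_wpM2l ?invr_ge0 //.
  exact: sum_iter_le hK hG.
Qed.

Lemma cesaro_ge (r b : V) (G : R) x :
  (forall x, G <= r x + markov_op b x - b x) ->
  G <= limn (fun T : nat => T%:R^-1 * (\sum_(t < T) iter t markov_op r x : R)).
Proof.
(* The lower bound is the upper bound for [- r] and [- b]. *)
move=> hG; have h z : (- r) z + markov_op (- b) z - (- b) z <= - G.
  rewrite linearN.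
  by have := hG z; rewrite !ffunE; lra.
have := @cesaro_le (- r) (- b) (- G) x h; rewrite lerNr => /le_trans; apply.
rewrite -limN; last exact: cesaro_cvg.
apply: ler_lim; [|exact: cesaro_cvg|].
- by apply: is_cvgN; exact: cesaro_cvg.
- apply: nearW => T /=; rewrite -mulrN ler_wpM2l ?invr_ge0 // opprfctE -sumrN.
  by apply: ler_sum => t _; rewrite iter_markov_opN ffunE opprK.
Qed.

End MarkovOperator.

(** * Bounds on the gain of a stationary policy by its one-step drift *)

Section Gain.
Context {R : realType} {St Act : finType} (p : St -> Act -> St -> R).
Context (rbar : St -> Act -> R) (pi : St -> Act).
Hypothesis kernel_p : mdp_kernel p.

Lemma exp_rewardE t x : exp_reward p rbar pi t x =
  iter t (markov_op (fun x => p x (pi x))) [ffun x => rbar x (pi x)] x.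
Proof.
rewrite /exp_reward; elim: t x => /= [|t IH] x; first by rewrite ffunE.
by rewrite /step ffunE; apply: eq_bigr => z _; rewrite IH.
Qed.

Lemma gainE x : gain p rbar pi x = limn (fun T : nat => T%:R^-1 *
  (\sum_(t < T) iter t (markov_op (fun x => p x (pi x))) [ffun x => rbar x (pi x)] x : R)).
Proof.
rewrite /gain; congr (limn _); apply/funext => T; congr (_ * _).
by apply: eq_bigr => t _; rewrite exp_rewardE.
Qed.

Lemma gain_le (b : St -> R) G x :
  (forall s, rbar s (pi s) + dotp (p s (pi s)) b - b s <= G) -> gain p rbar pi x <= G.
Proof.
move=> h; rewrite gainE; apply: (@cesaro_le _ _ _ _ _ _ [ffun z => b z]).
- by move=> s z; case: (kernel_p s (pi s)).
- by move=> s; case: (kernel_p s (pi s)).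
- move=> s; rewrite !ffunE; have := h s; rewrite /dotp.
  by under [X in _ -> _ + X - _ <= _]eq_bigr do rewrite ffunE.
Qed.

Lemma gain_ge (b : St -> R) G x :
  (forall s, G <= rbar s (pi s) + dotp (p s (pi s)) b - b s) -> G <= gain p rbar pi x.
Proof.
move=> h; rewrite gainE; apply: (@cesaro_ge _ _ _ _ _ _ [ffun z => b z]).
- by move=> s z; case: (kernel_p s (pi s)).
- by move=> s; case: (kernel_p s (pi s)).
- move=> s; rewrite !ffunE; have := h s; rewrite /dotp.
  by under [X in _ -> _ <= _ + X - _]eq_bigr do rewrite ffunE.
Qed.

End Gain.

(** * Pinsker's inequality and norm estimates *)

Section Pinsker.
Context {R : realType}.

(* The difference of the two sides has derivative
   [(u - 1) ^ 3 / (u ^ 2 (u + 2) ^ 2)], so it is minimal, and zero, at [1]. *)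
Lemma ln_ge_rational (u : R) : 0 < u ->
  (u - 1) * (5 * u + 1) / (2 * u * (u + 2)) <= ln u.
Proof.
move=> u0; rewrite -subr_ge0.
pose D (u : R) : R := ln u + 4^-1 * u^-1 + 27 / 4 * (u + 2)^-1.
have -> : ln u - (u - 1) * (5 * u + 1) / (2 * u * (u + 2)) = D u - D 1.
  by rewrite /D ln1; field; rewrite !gt_eqF // ?addr_gt0.
have dD (x : R) : 0 < x -> is_derive x 1 D ((x - 1) ^+ 3 / (x ^+ 2 * (x + 2) ^+ 2)).
  move=> x0; have nz : x + 2 != 0 by rewrite gt_eqF // addr_gt0.
  have nx : x != 0 by rewrite gt_eqF.
  have h1 := is_derive1_ln x0.
  have h2 : is_derive x 1 (fun u : R => u + 2) 1.
    by apply: is_derive_eq; rewrite addr0.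
  have h3 : is_derive x 1 (fun u : R => (u + 2)^-1) (- (x + 2) ^- 2 *: 1).
    exact: is_deriveV.
  have h4 : is_derive x 1 (fun u : R => u^-1) (- x ^- 2 *: 1).
    exact: is_deriveV.
  rewrite /D; apply: is_derive_eq.
  by rewrite /GRing.scale /=; field; rewrite nx nz.
have mvt (x z : R) : 0 < x -> x <= z -> exists2 c, c \in `[x, z] &
    D z - D x = (c - 1) ^+ 3 / (c ^+ 2 * (c + 2) ^+ 2) * (z - x).
  move=> x0 xz; apply: MVT_segment => // [c|].
    by rewrite in_itv /= => /andP[xc _]; apply: dD; exact: lt_trans xc.
  apply: derivable_within_continuous => c; rewrite in_itv /= => /andP[xc _].
  by case: (dD c (lt_le_trans x0 xc)).
have den (c : R) : 0 <= c ^+ 2 * (c + 2) ^+ 2 by rewrite mulr_ge0 ?sqr_ge0.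
have [u1|u1] := leP u 1.
  have [c] := mvt u 1 u0 u1; rewrite in_itv /= => /andP[uc c1] e.
  rewrite -opprB e -mulNr mulr_ge0 ?subr_ge0 // -mulNr mulr_ge0 ?invr_ge0 //.
  by rewrite exprS -mulNr mulr_ge0 ?sqr_ge0 // opprB subr_ge0.
have [c] := mvt 1 u ltr01 (ltW u1); rewrite in_itv /= => /andP[uc c1] ->.
rewrite mulr_ge0 ?subr_ge0 ?(ltW u1) // mulr_ge0 ?invr_ge0 //.
by rewrite exprn_ge0 // subr_ge0.
Qed.

Lemma kl_term_ge (a b : R) : 0 < a -> 0 < b ->
  3 / 2 * (a - b) ^+ 2 / (a + 2 * b) <= a * ln (a / b) - a + b.
Proof.
move=> a0 b0; have := ln_ge_rational _ (divr_gt0 a0 b0).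
rewrite -(ler_pM2l a0) => h; rewrite -[leRHS]addrA -lerBlDr; apply: le_trans h.
have e : a + 2 * b != 0 by rewrite gt_eqF // addr_gt0 // mulr_gt0.
(* After [ln_ge_rational] at [a / b], what remains is an identity: both sides equal [(a - b) * (5 *
   a + b) / (2 * (a + 2 * b))] up to moving [a - b] across. *)
rewrite le_eqVlt; apply/orP; left; apply/eqP; field.
by rewrite e !gt_eqF.
Qed.

(** This is [kl_term_ge] after [X ^ 2 / Y >= 2 t X - t ^ 2 Y] with [X = |a - b|] and [Y = a + 2 b].
    Being linear in [X] and [Y], the bound can be summed over states with a common [t], in place of
    Cauchy-Schwarz. The case [a = 0] is a direct quadratic estimate. *)
Lemma kl_term_ge_tangent (a b t : R) : 0 <= a -> 0 <= b -> (0 < a -> 0 < b) ->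
  3 * t * `|a - b| - 3 / 2 * t ^+ 2 * (a + 2 * b) <=
  (if 0 < a then a * ln (a / b) else 0) - a + b.
Proof.
rewrite [0 <= a]le_eqVlt => /predU1P[<-|a0] b0 ab; last first.
  rewrite a0; have {}b0 := ab a0; apply: le_trans (kl_term_ge _ _ a0 b0).
  have e : 0 < a + 2 * b by rewrite addr_gt0 // mulr_gt0.
  rewrite -subr_ge0 -(real_normK (num_real (a - b))).
  have -> : 3 / 2 * `|a - b| ^+ 2 / (a + 2 * b) -
     (3 * t * `|a - b| - 3 / 2 * t ^+ 2 * (a + 2 * b)) =
     3 / 2 * (`|a - b| - t * (a + 2 * b)) ^+ 2 / (a + 2 * b).
    by field; rewrite gt_eqF.
  by rewrite divr_ge0 ?(ltW e) // mulr_ge0 ?sqr_ge0 // divr_ge0.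
rewrite ltxx sub0r normrN ger0_norm // !add0r oppr0 add0r -subr_ge0.
have -> : b - (3 * t * b - 3 / 2 * t ^+ 2 * (2 * b)) =
  b * (3 * (t - 2^-1) ^+ 2 + 4^-1) by field.
by rewrite mulr_ge0 // addr_ge0 ?invr_ge0 // mulr_ge0 ?sqr_ge0.
Qed.

Lemma pinsker (St : finType) (p q : St -> R) : simplex p -> simplex q ->
  (forall s, 0 < p s -> 0 < q s) ->
  (\sum_s `|p s - q s|) ^+ 2 <= 2 * \sum_(s | 0 < p s) p s * ln (p s / q s).
Proof.
(* The weights [p s + 2 * q s] sum to 3, so the summed bound is [3 t L - 9/2 t ^ 2]; its maximum, at
   [t = L / 3], is [L ^ 2 / 2]. *)
move=> [p0 p1] [q0 q1] ac; set L := \sum_s _; pose t := L / 3.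
have : \sum_s (3 * t * `|p s - q s| - 3 / 2 * t ^+ 2 * (p s + 2 * q s)) <=
    \sum_s ((if 0 < p s then p s * ln (p s / q s) else 0) - p s + q s).
  by apply: ler_sum => s _; apply: kl_term_ge_tangent => //; exact: ac.
rewrite [leRHS]big_split [X in _ <= X + _]big_split /= q1 sumrN p1 subrK -big_mkcond /=.
rewrite sumrB -!mulr_sumr -/L big_split /= -mulr_sumr p1 q1 => h.
suff -> : L ^+ 2 = 2 * (3 * t * L - 3 / 2 * t ^+ 2 * (1 + 2 * 1)).
  by rewrite ler_pM2l.
by rewrite /t; field.
Qed.

Lemma ler_supnorm (St : finType) (b : St -> R) s : `|b s| <= supnorm b.
Proof. by rewrite /supnorm; apply: le_bigmax. Qed.

Lemma supnorm_ge0 (St : finType) (b : St -> R) : 0 <= supnorm b.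
Proof. by rewrite /supnorm; elim/big_ind: _ => // x y x0 y0; rewrite le_max x0. Qed.

Lemma ler_dotp_sub (St : finType) (p q b : St -> R) :
  `|dotp p b - dotp q b| <= supnorm b * \sum_s `|p s - q s|.
Proof.
rewrite /dotp -sumrB mulr_sumr (le_trans (ler_norm_sum _ _ _)) //.
by apply: ler_sum => s _; rewrite -mulrBl normrM mulrC ler_wpM2r // ler_supnorm.
Qed.

Lemma ler_dotp_simplex (St : finType) (q b : St -> R) :
  simplex q -> `|dotp q b| <= supnorm b.
Proof.
move=> [q0 q1]; rewrite /dotp (le_trans (ler_norm_sum _ _ _)) //.
rewrite -[leRHS]mul1r -q1 mulr_suml; apply: ler_sum => s _.
by rewrite normrM ger0_norm // ler_wpM2l // ler_supnorm.
Qed.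

End Pinsker.

(** * Both pairs of bounds bracket every element of the KL ball *)

Section Confidence.
Context {R : realType} {St Act : finType}.
Implicit Types (ph q b : St -> R) (N : nat).

Lemma Ukl_ge delta ph N q b : KLball Act delta ph N q ->
  ((dotp q b)%:E <= Ukl Act delta ph N b)%E.
Proof.
move=> hq; rewrite /Ukl lee_fin; apply: ub_le_sup; last by exists q.
(* The real [sup] is an upper bound only for a set bounded above; the simplex provides this. *)
exists (supnorm b) => _ [q' [sq' _] <-].
exact: le_trans (ler_norm _) (ler_dotp_simplex _ _ b sq').
Qed.

Lemma Lkl_le delta ph N q b : KLball Act delta ph N q ->
  (Lkl Act delta ph N b <= (dotp q b)%:E)%E.
Proof.
move=> hq; rewrite /Lkl lee_fin; apply: ge_inf; last by exists q.
exists (- supnorm b) => _ [q' [sq' _] <-].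
by rewrite lerNl (le_trans _ (ler_dotp_simplex _ _ b sq')) // -normrN ler_norm.
Qed.

Lemma KLball_dotp delta ph N q b : (0 < N)%N -> simplex ph -> KLball Act delta ph N q ->
  `|dotp ph b - dotp q b| <= supnorm b * Num.sqrt (2 * xthr St Act delta N%:R / N%:R).
Proof.
move=> N0 sph [sq [N0'|]]; first by rewrite N0' in N0.
have N0R : 0 < N%:R :> R by rewrite ltr0n.
(* Without absolute continuity the divergence is infinite, and since [N > 0] so is its multiple,
   which no finite threshold dominates. *)
rewrite /KL; case: ifPn => [/forallP ac|_]; last by rewrite gt0_muley ?lte_fin.
rewrite -EFinM lee_fin => h.
rewrite (le_trans (ler_dotp_sub _ _ _ _)) // ler_wpM2l ?supnorm_ge0 //.
rewrite -[leLHS]ger0_norm ?sumr_ge0 // -sqrtr_sqr ler_wsqrtr //.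
apply: le_trans (pinsker _ _ _ sph sq _) _; first by move=> s; apply/implyP.
rewrite -mulrA ler_pM2l // ler_pdivlMr // mulrC.
exact: h.
Qed.

Lemma Utl_ge delta ph N q b : ((0 < N)%N -> simplex ph) -> KLball Act delta ph N q ->
  ((dotp q b)%:E <= Utl Act delta ph N b)%E.
Proof.
rewrite /Utl; case: eqP => [_ _|/eqP]; first by rewrite leey.
rewrite -lt0n => N0 /(_ N0) sph /(KLball_dotp _ _ _ _ b N0 sph).
by rewrite lee_fin ler_distlC => /andP[].
Qed.

Lemma Ltl_le delta ph N q b : ((0 < N)%N -> simplex ph) -> KLball Act delta ph N q ->
  (Ltl Act delta ph N b <= (dotp q b)%:E)%E.
Proof.
rewrite /Ltl; case: eqP => [_ _|/eqP]; first by rewrite leNye.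
rewrite -lt0n => N0 /(_ N0) sph /(KLball_dotp _ _ _ _ b N0 sph).
by rewrite lee_fin ler_distlC => /andP[].
Qed.

End Confidence.

(** * Preliminaries on sigma-algebras and finite unions *)

Section Measure.
Context {R : realType} {d : measure_display} {T : measurableType d}.

Lemma sigma_algebraI (G : set (set T)) (A B : set T) :
  sigma_algebra setT G -> G A -> G B -> G (A `&` B).
Proof.
move=> sG; rewrite -(sigma_algebra_id sG).
exact: (@measurableI _ (g_sigma_algebraType G)).
Qed.

Lemma measure_le_sum_fin (P : probability T R) (I : finType) (A : I -> set T) (B : set T) :
  measurable B -> (forall i, measurable (A i)) ->
  B `<=` [set w | exists i, A i w] -> (P B <= \sum_i P (A i))%E.
Proof.
move=> mB mA BA; pose C := \big[setU/set0]_i A i.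
have mC : measurable C by exact: bigsetU_measurable.
apply: (@le_trans _ _ (P C)).
  apply: le_measure; rewrite ?inE // => w /BA[i Aiw].
  by rewrite /C (bigD1 i) //=; left.
have [mC' //] : measurable C /\ (P C <= \sum_i P (A i))%E.
rewrite /C; elim/big_ind2: _ => // [|X a Y b [mX Xa] [mY Yb]].
  by rewrite measure0.
split; first exact: measurableU.
exact: (le_trans (measureU2 _ _ _) (leeD _ _)).
Qed.

End Measure.

(** * Ville's inequality along the visits to one state-action pair *)

Section Ville.
Context {R : realType} {St Act : finType} {d : measure_display} {T : measurableType d}.
Context (P : probability T R) (F : nat -> set (set T)) (p : St -> Act -> St -> R).
Context (sa : nat -> T -> St * Act) (y : nat -> T -> St).
Hypothesis rule : sampling_rule P F p sa y.
Hypothesis kernel_p : mdp_kernel p.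
Context (s : St) (a : Act).

(** The only statistic through which the history enters the supermartingale. *)
Definition counts (n : nat) (w : T) : {ffun St -> nat} :=
  [ffun z => \sum_(t < n) ((sa t w == (s, a)) && (y t w == z))]%N.

Definition count_incr (c : {ffun St -> nat}) (z : St) : {ffun St -> nat} :=
  [ffun z' => c z' + (z == z')]%N.

Lemma counts0 w : counts 0 w = [ffun=> 0%N].
Proof. by apply/ffunP => z; rewrite !ffunE big_ord0. Qed.

Lemma countsS n w : counts n.+1 w =
  if sa n w == (s, a) then count_incr (counts n w) (y n w) else counts n w.
Proof.
apply/ffunP => z; rewrite ffunE big_ord_recr /=.
by case: ifPn => _; rewrite !ffunE /= ?addn0.
Qed.

Let X n : set T := [set w | sa n w = (s, a)].
Let Y n z : set T := [set w | y n w = z].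

Lemma sampling_rule_measurable n A : F n A -> measurable A.
Proof. by have [_ [Fm _]] := rule; exact: Fm. Qed.
Arguments sampling_rule_measurable {n A}.

Let FX n : F n (X n).
Proof. by have [_ [_ [_ [h _]]]] := rule; exact: h. Qed.

Let FY n z : F n.+1 (Y n z).
Proof. by have [_ [_ [_ [_ [h _]]]]] := rule; exact: h. Qed.

Let FI n A B : F n A -> F n B -> F n (A `&` B).
Proof. by have [sF _] := rule; exact: sigma_algebraI. Qed.

Let FC n A : F n A -> F n (~` A).
Proof. by have [sF _] := rule; have [_ FD _] := sF n; rewrite -setTD; exact: FD. Qed.

Let FS n A : F n A -> F n.+1 A.
Proof. by have [_ [_ [h _]]] := rule; exact: h. Qed.

(** The set [D] is arbitrary so that the induction also covers its preimages under [count_incr]; the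
    last sample is split according to whether [(s, a)] is visited and which state follows. *)
Lemma measurable_counts n (D : set {ffun St -> nat}) : measurable [set w | D (counts n w)].
Proof.
elim: n D => [|n IH] D.
  have [D0|D0] := pselect (D [ffun=> 0%N]).
    rewrite (_ : [set _ | _] = setT) //; apply/seteqP; split => // w _ /=.
    by rewrite counts0.
  rewrite (_ : [set _ | _] = set0) //; apply/seteqP; split => // w /=.
  by rewrite counts0.
have mX := sampling_rule_measurable (FX n).
have mY z := sampling_rule_measurable (FY n z).
rewrite (_ : [set _ | _] = (~` X n `&` [set w | D (counts n w)]) `|`
  \bigcup_(z in [set: St]) (X n `&` Y n z `&` [set w | D (count_incr (counts n w) z)])).
  apply: measurableU; first by apply: measurableI => //; exact: measurableC.
  apply: fin_bigcup_measurable => // z _; apply: measurableI; first exact: measurableI.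
  exact: (IH (fun c => D (count_incr c z))).
apply/seteqP; split => w /=; rewrite countsS.
  by case: eqP => [e|e] Dw; [right; exists (y n w)|left].
by case: eqP => [e [[//]|[z _ [[_ /= <-]]]]|e [[]|[z _ [[]]]]].
Qed.

(** The level 1 is reached at some time from [n] to [n + m]. Peeling off the earliest time matches
    conditioning on the next transition. *)
Fixpoint hits (V : {ffun St -> nat} -> R) (m n : nat) : set T :=
  [set w | 1 <= V (counts n w)] `|` (if m is m'.+1 then hits V m' n.+1 else set0).

Lemma measurable_hits V m n : measurable (hits V m n).
Proof.
have mV k := measurable_counts k (fun c => 1 <= V c).
elim: m n => [|m IH] n /=; first by rewrite setU0; exact: mV.
by apply: measurableU; [exact: mV|exact: IH].
Qed.

Lemma hitsP V m n k w : (k <= m)%N -> 1 <= V (counts (n + k) w) -> hits V m n w.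
Proof.
elim: m n k => [|m IH] n [|k] //=; rewrite ?addn0 ?ltnS; try by left.
by move=> km; rewrite addnS -addSn => h; right; exact: IH km h.
Qed.

Section Supermartingale.
Context (V : {ffun St -> nat} -> R).
Hypothesis V_ge0 : forall c, 0 <= V c.
Hypothesis V_super : forall c, \sum_z p s a z * V (count_incr c z) <= V c.

(* [V (counts n)] is a supermartingale that starts at [V c] on the event [H]; conditioning on
   the next transition from [(s, a)] gives the maximal inequality by induction on the
   horizon, with no integration. *)
Lemma maximal_inequality m n (H : set T) c : F n H -> H `<=` [set w | counts n w = c] ->
  (P (H `&` hits V m n) <= (V c)%:E * P H)%E.
Proof.
elim: m n H c => [|m IH] n H c FH Hc; have mH := sampling_rule_measurable FH;
  have [Vc|Vc] := leP 1 (V c).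
- rewrite (@le_trans _ _ (P H)) ?le_measure ?inE //.
    exact: measurableI (measurable_hits _ _ _).
  by rewrite -[leLHS]mul1e lee_wpmul2r // lee_fin.
- rewrite (_ : _ `&` _ = set0) ?measure0 ?mule_ge0 ?lee_fin //.
  apply/seteqP; split => // w [/Hc /= wc] [] //=.
  by rewrite wc leNgt Vc.
- rewrite (@le_trans _ _ (P H)) ?le_measure ?inE //.
    exact: measurableI (measurable_hits _ _ _).
  by rewrite -[leLHS]mul1e lee_wpmul2r // lee_fin.
(* On [H] the value at time [n] is [V c < 1], so the level can be reached only later. *)
have -> : H `&` hits V m.+1 n = H `&` hits V m n.+1.
  apply/seteqP; split => w [Hw /=]; last by move=> ?; split => //; right.
  by case => // /=; rewrite (Hc _ Hw) leNgt Vc.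
have mX := sampling_rule_measurable (FX n).
have mh := measurable_hits V m n.+1.
pose H0 := H `&` ~` X n; pose H1 := H `&` X n; pose Hz z := H1 `&` Y n z.
have FH0 : F n H0 by apply: FI => //; exact: FC.
have FH1 : F n H1 by exact: FI.
have FHz z : F n.+1 (Hz z) by apply: FI (FY n z); exact: FS.
have mH0 := sampling_rule_measurable FH0.
have mH1 := sampling_rule_measurable FH1.
have mHz z := sampling_rule_measurable (FHz z).
have PH : P H = (P H0 + P H1)%E.
  by rewrite -[X in P X](setIT H) -(setvU (X n)) setIUr measureU // setIACA setICl setI0.
have h0 : (P (H0 `&` hits V m n.+1) <= (V c)%:E * P H0)%E.
  apply: IH; first exact: FS.
  move=> w [/Hc /= wc Xw]; rewrite countsS; case: eqP => // e.
have h1 : (P (H1 `&` hits V m n.+1) <= (V c)%:E * P H1)%E.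
  (* On each [Hz z] the counts at time [n.+1] are [count_incr c z], so the induction hypothesis
     applies; the sampling rule gives [Hz z] the probability [p s a z * P H1], and [V_super] bounds
     the sum. *)
  apply: (@le_trans _ _ (\sum_z P (Hz z `&` hits V m n.+1))%E).
    apply: measure_le_sum_fin => [|z|w [H1w hw]]; [exact: measurableI..|].
    by exists (y n w).
  apply: (@le_trans _ _ (\sum_z (V (count_incr c z) * p s a z)%:E * P H1)%E).
    apply: lee_sum => z _; have [_ [_ [_ [_ [_ h]]]]] := rule.
    rewrite EFinM -muleA -(h n H s a z FH); apply: IH => // w [[/Hc /= wc Xw] Yw].
    by rewrite /= countsS Xw eqxx wc Yw.
  rewrite -ge0_sume_distrl => [|z _]; last first.
    by rewrite lee_fin mulr_ge0 //; case: (kernel_p s a).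
  rewrite sumEFin lee_wpmul2r // lee_fin.
  by under eq_bigr do rewrite mulrC.
rewrite PH ge0_muleDr // (le_trans _ (leeD h0 h1)) //.
apply: le_trans (measureU2 _ _ _); [|exact: measurableI..].
apply: le_measure; rewrite ?inE; [exact: measurableI|by apply: measurableU; exact: measurableI|].
move=> w [Hw hw]; have [Xw|Xw] := pselect (X n w); [right|left]; split => //.
Qed.

(** The horizon of [maximal_inequality] tends to infinity by continuity from below, starting from
    the sure event at time 0, where all counts vanish. *)
Lemma ville : exists B : set T, [/\ measurable B,
  (forall w, ~ B w -> forall n, V (counts n w) < 1) &
  (P B <= (V [ffun=> 0%N])%:E)%E].
Proof.
exists (\bigcup_m hits V m 0); split.
- by apply: bigcup_measurable => m _; exact: measurable_hits.
- move=> w Bw n; rewrite ltNge; apply/negP => h; apply: Bw; exists n => //.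
  exact: (@hitsP _ _ 0%N n).
have mb : measurable (\bigcup_m hits V m 0).
  by apply: bigcup_measurable => m _; exact: measurable_hits.
have hmono : {homo (fun m => hits V m 0) : m n / (m <= n)%N >-> (m <= n)%O}.
  move=> m n mn; apply/subsetPset.
  elim: m n (0%N) mn => [|m IH] [|n] k //= mn w.
  - by case => // h; left.
  - by case => // h; left.
  - by case => h; [left|right; exact: IH h].
have c := nondecreasing_cvg_mu (mu := P) (fun m => measurable_hits V m 0) mb hmono.
rewrite -(cvg_lim _ c) //; apply: lime_le; first by apply/cvg_ex; eexists; exact: c.
apply: nearW => m /=.
have := @maximal_inequality m 0 setT [ffun=> 0%N]; rewrite setTI probability_setT mule1.
apply; last by move=> w _; exact: counts0.
have [sF _] := rule; have [F0 FD _] := sF 0%N.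
by rewrite -(setD0 setT); exact: FD.
Qed.

End Supermartingale.
End Ville.

(** * Estimates for [n ^ n / n!] and binomial coefficients *)

Section PowerOverFactorial.
Context {R : realType}.

Definition pow_fact (n : nat) : R := n%:R ^+ n / n`!%:R.

Lemma pow_fact_gt0 n : 0 < pow_fact n.
Proof.
rewrite divr_gt0 ?ltr0n ?fact_gt0 //; case: n => [|n]; first by rewrite expr0.
by rewrite exprn_gt0.
Qed.

(* [(a + b) ^ (a + b)] dominates the term ['C(a + b, b) a ^ a b ^ b] of its binomial expansion. *)
Lemma bin_pow_le (a b : nat) : ('C(a + b, b) * (a ^ a * b ^ b) <= (a + b) ^ (a + b))%N.
Proof.
have hb : (b < (a + b).+1)%N by rewrite ltnS leq_addl.
by rewrite expnDn (bigD1 (Ordinal hb)) //= addnK leq_addr.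
Qed.

Lemma pow_factD a b : pow_fact a * pow_fact b <= pow_fact (a + b).
Proof.
rewrite /pow_fact mulf_div ler_pdivrMr ?mulr_gt0 ?ltr0n ?fact_gt0 //.
rewrite mulrAC ler_pdivlMr ?ltr0n ?fact_gt0 //.
have := bin_pow_le a b; rewrite -(ler_nat R) -(ler_pM2r (x := (a`! * b`!)%:R)); last first.
  by rewrite ltr0n muln_gt0 !fact_gt0.
rewrite -!natrX -!natrM !ler_nat; apply: leq_trans.
rewrite -(bin_fact (leq_addl a b)) addnK; apply/eq_leq; ring.
Qed.

(** For a positive total [N], this says that the multinomial law with parameters [c i / N] gives the
    count vector [c] probability at most 1. *)
Lemma prod_pow_fact_le (I : finType) (c : I -> nat) :
  \prod_i pow_fact (c i) <= pow_fact (\sum_i c i).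
Proof.
have [] // : 0 <= \prod_i pow_fact (c i) /\ \prod_i pow_fact (c i) <= pow_fact (\sum_i c i).
elim/big_ind2: _ => [|x m z n [x0 xm] [z0 zn]|i _]; rewrite ?(ltW (pow_fact_gt0 _)) //.
  by rewrite /pow_fact expr0 fact0 divr1.
split; first exact: mulr_ge0.
by apply: le_trans (pow_factD _ _); exact: ler_pM.
Qed.

(** By [bin_pow_le] the coefficient is at most [(1 + k / N) ^ N * (1 + N / k) ^ k], and the first
    factor is at most [e ^ k]. *)
Lemma bin_le_expR (N k : nat) : (0 < N)%N -> (0 < k)%N ->
  'C(N + k, k)%:R <= (expR 1 * (1 + N%:R / k%:R)) ^+ k :> R.
Proof.
move=> N0 k0; have Nn : N%:R != 0 :> R by rewrite pnatr_eq0 -lt0n.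
have kn : k%:R != 0 :> R by rewrite pnatr_eq0 -lt0n.
have h : 'C(N + k, k)%:R <= (1 + k%:R / N%:R) ^+ N * (1 + N%:R / k%:R) ^+ k :> R.
  have := bin_pow_le N k; rewrite -(ler_nat R) natrX natrD !natrM !natrX.
  have -> : 1 + k%:R / N%:R = (N%:R + k%:R) / N%:R :> R by rewrite mulrDl divff.
  have -> : 1 + N%:R / k%:R = (N%:R + k%:R) / k%:R :> R by rewrite mulrDl divff // addrC.
  rewrite !expr_div_n mulf_div -exprD ler_pdivlMr //.
  by rewrite mulr_gt0 // exprn_gt0 ?ltr0n.
apply: (le_trans h); rewrite exprMn ler_wpM2r ?exprn_ge0 ?addr_ge0 ?divr_ge0 //.
have -> : expR 1 ^+ k = expR (k%:R / N%:R) ^+ N :> R.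
  by rewrite -!expRM_natl mulr1 mulrC divfK.
by rewrite lerXn2r ?nnegrE ?expR_ge0 ?expR_ge1Dx ?addr_ge0 ?divr_ge0.
Qed.

End PowerOverFactorial.

(** * The Laplace mixture as a supermartingale and its link to KL *)

Section LaplaceMixture.
Context {R : realType} {St : finType} (q : St -> R).
Hypothesis q_ge0 : forall z, 0 <= q z.
Implicit Types c : {ffun St -> nat}.

Definition total_count c : nat := (\sum_z c z)%N.

(** Where this fails, some [q z ^ c z] is zero and, as division by zero returns zero,
    [laplace_ratio] is 0 instead of infinite. *)
Definition abs_cont c : bool := [forall z, (0 < c z)%N ==> (0 < q z)].

(* Likelihood ratio between the uniform (Dirichlet) mixture of all laws on [St] and [q]. *)
Definition laplace_ratio c : R :=
  (\prod_z ((c z)`!%:R / q z ^+ c z)) * (#|St|.-1)`!%:R / (total_count c + #|St|.-1)`!%:R.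

Lemma laplace_ratio_ge0 c : 0 <= laplace_ratio c.
Proof. by rewrite !mulr_ge0 ?invr_ge0 // prodr_ge0 // => z _; rewrite divr_ge0 ?exprn_ge0. Qed.

Lemma abs_cont_exprn_gt0 c z : abs_cont c -> 0 < q z ^+ c z.
Proof.
move=> /forallP /(_ z); case: (c z) => [|n]; first by rewrite expr0.
by rewrite /= => qz; rewrite exprn_gt0.
Qed.

Lemma laplace_ratio_gt0 c : abs_cont c -> 0 < laplace_ratio c.
Proof.
move=> ac; rewrite /laplace_ratio !(mulr_gt0, divr_gt0) ?ltr0n ?fact_gt0 //.
by apply: prodr_gt0 => z _; rewrite divr_gt0 ?ltr0n ?fact_gt0 ?abs_cont_exprn_gt0.
Qed.

Lemma laplace_ratio0 : laplace_ratio [ffun=> 0%N] = 1.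
Proof.
rewrite /laplace_ratio /total_count big1 => [|z _]; last by rewrite ffunE expr0 divr1.
by rewrite big1 => [|z _]; rewrite ?ffunE // mul1r divff // pnatr_eq0 -lt0n fact_gt0.
Qed.

Lemma total_incr c z : total_count (count_incr c z) = (total_count c).+1.
Proof.
rewrite /total_count (bigD1 z) //= [in RHS](bigD1 z) //= ffunE eqxx addn1 addSn.
by congr (_ + _).+1; apply: eq_bigr => i iz; rewrite ffunE eq_sym (negPf iz) addn0.
Qed.

(** Laplace's rule of succession: the mixture predicts [z] with probability [(c z + 1) / (N + S)].
    For [q z = 0] both sides vanish. *)
Lemma laplace_ratio_incr c z : q z * laplace_ratio (count_incr c z) =
  (if 0 < q z then (c z).+1%:R / (total_count c + #|St|)%:R else 0) * laplace_ratio c.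
Proof.
have [qz|] := ltP 0 (q z); last first.
  by move=> qz; have -> : q z = 0; [apply/eqP; rewrite eq_le qz q_ge0|rewrite !mul0r].
rewrite /laplace_ratio total_incr addSn.
have St0 : (0 < #|St|)%N by apply/card_gt0P; exists z.
have -> : (total_count c + #|St|)%N = (total_count c + #|St|.-1).+1 by rewrite -addnS prednK.
rewrite (bigD1 z) //= [in RHS](bigD1 z) //= ffunE eqxx addn1.
rewrite (eq_bigr (fun i => (c i)`!%:R / q i ^+ c i)); last first.
  by move=> i iz; rewrite ffunE eq_sym (negPf iz) addn0.
rewrite !factS exprS !natrM; field.
have qn : q z != 0 by rewrite gt_eqF.
by rewrite -natrD nat1r !pnatr_eq0 -lt0n fact_gt0 expf_neq0.
Qed.

(** The predictive probabilities sum to 1; only an inequality remains because the [q]-null states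
    drop out. *)
Lemma laplace_ratio_super c : \sum_z q z * laplace_ratio (count_incr c z) <= laplace_ratio c.
Proof.
under eq_bigr do rewrite laplace_ratio_incr.
rewrite -mulr_suml -[leRHS]mul1r ler_wpM2r ?laplace_ratio_ge0 //.
have [St0|St0] := posnP #|St|.
  by rewrite big1 // => z; have := card0_eq St0 z; rewrite inE.
apply: (@le_trans _ _ (\sum_z (c z).+1%:R / (total_count c + #|St|)%:R)).
  by apply: ler_sum => z _; case: ifP => // _; rewrite divr_ge0.
rewrite -mulr_suml -natr_sum ler_pdivrMr ?mul1r ?ltr0n ?addn_gt0 ?St0 ?orbT // ler_nat.
by under eq_bigr do rewrite -addn1; rewrite big_split /= sum1_card.
Qed.

Lemma abs_cont_incr c z : abs_cont c -> 0 < q z -> abs_cont (count_incr c z).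
Proof.
move=> /forallP ac qz; apply/forallP => z'; rewrite ffunE.
by have [<-|_] := eqVneq z z'; rewrite ?qz ?implybT // addn0; exact: ac.
Qed.

(* Value [1] on counts that charge a [q]-null state, which almost surely never occur. *)
Definition ville_fun (r : R) c : R := if abs_cont c then r * laplace_ratio c else 1.

Lemma ville_fun_ge0 r c : 0 <= r -> 0 <= ville_fun r c.
Proof. by move=> r0; rewrite /ville_fun; case: ifP => // _; rewrite mulr_ge0 ?laplace_ratio_ge0. Qed.

(** Only a [q]-null state, of weight zero, can break [abs_cont]; once broken it stays so, and the
    value remains 1. *)
Lemma ville_fun_super r c : 0 <= r -> \sum_z q z = 1 ->
  \sum_z q z * ville_fun r (count_incr c z) <= ville_fun r c.
Proof.
move=> r0 q1; rewrite {2}/ville_fun; case: ifPn => [ac|nac].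
  apply: le_trans (ler_wpM2l r0 (laplace_ratio_super c)).
  rewrite mulr_sumr; apply: ler_sum => z _; rewrite mulrCA.
  have := q_ge0 z; rewrite le_eqVlt => /predU1P[<-|qz]; first by rewrite !mul0r.
  by rewrite /ville_fun abs_cont_incr.
rewrite -q1; apply: ler_sum => z _; rewrite /ville_fun ifN ?mulr1 //.
apply: contra nac => /forallP ac; apply/forallP => z'; apply/implyP => cz.
by apply: (implyP (ac z')); rewrite ffunE addn_gt0 cz.
Qed.

Lemma ville_fun0 r : ville_fun r [ffun=> 0%N] = r.
Proof.
rewrite /ville_fun laplace_ratio0 mulr1 ifT //.
by apply/forallP => z; rewrite ffunE.
Qed.

(** The left side is the logarithm of [A], the likelihood ratio of the empirical law to [q]. Then
    [A <= M / N!], which is [laplace_ratio c] times ['C(N + k, k)], and [bin_le_expR] bounds the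
    binomial coefficient. *)
Lemma kl_le_laplace_ratio c : (0 < total_count c)%N -> abs_cont c ->
  \sum_(z | 0 < (c z)%:R / (total_count c)%:R :> R)
    (c z)%:R * ln ((c z)%:R / (total_count c)%:R / q z) <=
  ln (laplace_ratio c) +
  (#|St|%:R - 1) * ln (expR 1 * (1 + (total_count c)%:R / (#|St|%:R - 1))).
Proof.
move=> N0 ac; have qc z := abs_cont_exprn_gt0 c z ac.
have [St0|St0] := posnP #|St|.
  by move: N0; rewrite /total_count big1 // => z; have := card0_eq St0 z; rewrite inE.
set N := total_count c; set k := #|St|.-1.
have Nr : 0 < N%:R :> R by rewrite ltr0n.
have -> : #|St|%:R - 1 = k%:R :> R by rewrite /k -subn1 natrB.
pose A := \prod_z (((c z)%:R / N%:R) ^+ c z / q z ^+ c z).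
have cc z : 0 < (c z)%:R ^+ c z :> R.
  by case: (c z) => [|n]; rewrite ?expr0 // exprn_gt0.
have fg n : 0 < n`!%:R :> R by rewrite ltr0n fact_gt0.
have Apos z : 0 < ((c z)%:R / N%:R) ^+ c z / q z ^+ c z.
  by rewrite divr_gt0 // expr_div_n divr_gt0 // exprn_gt0.
have lnA : \sum_(z | 0 < (c z)%:R / N%:R :> R) (c z)%:R * ln ((c z)%:R / N%:R / q z) = ln A.
  have -> : ln A = \sum_z ln (((c z)%:R / N%:R) ^+ c z / q z ^+ c z).
    (* Positivity is carried along because [ln] turns products into sums only for positive
       factors. *)
    rewrite /A; have [//] : 0 < \prod_z (((c z)%:R / N%:R) ^+ c z / q z ^+ c z) /\
      ln (\prod_z (((c z)%:R / N%:R) ^+ c z / q z ^+ c z)) =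
      \sum_z ln (((c z)%:R / N%:R) ^+ c z / q z ^+ c z).
    elim/big_ind2: _ => [|x u v w [x0 <-] [v0 <-]|i _]; rewrite ?ln1 //.
    by rewrite mulr_gt0 // lnM // posrE.
  rewrite big_mkcond; apply: eq_bigr => z _.
  have := forallP ac z; rewrite pmulr_lgt0 ?invr_gt0 // ltr0n -expr_div_n.
  case: posnP => [->|cz /= qz]; first by rewrite expr0 ln1.
  have cR : 0 < (c z)%:R :> R by rewrite ltr0n.
  have qz' : 0 < (c z)%:R / N%:R / q z by rewrite !divr_gt0.
  by rewrite lnXn // mulr_natl.
have Agt : 0 < A by apply: prodr_gt0 => z _.
pose M := \prod_z ((c z)`!%:R / q z ^+ c z).
have Mgt : 0 < M by apply: prodr_gt0 => z _; rewrite divr_gt0.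
have AM : A <= M / N`!%:R.
  (* Replacing the product by [pow_fact N] cancels [N ^ N] and leaves [M / N!]. *)
  have -> : A = (\prod_z pow_fact (c z)) * (M / N%:R ^+ N).
    have -> : N%:R ^+ N = \prod_z N%:R ^+ c z :> R by rewrite prodrXr.
    rewrite /M /A -prodf_div -big_split /=.
    apply: eq_bigr => z _; rewrite /pow_fact expr_div_n; field.
    by rewrite !gt_eqF // exprn_gt0.
  apply: le_trans (ler_wpM2r _ (prod_pow_fact_le _ _)) _.
    by rewrite divr_ge0 ?exprn_ge0 // ltW.
  rewrite le_eqVlt; apply/orP; left; apply/eqP; rewrite /pow_fact -/(total_count c) -/N; field.
  by rewrite !gt_eqF ?exprn_gt0.
have Bgt : 0 < 'C(N + k, k)%:R :> R by rewrite ltr0n bin_gt0 leq_addl.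
have Lgt := laplace_ratio_gt0 c ac.
have ML : M / N`!%:R = laplace_ratio c * 'C(N + k, k)%:R.
  rewrite /laplace_ratio -/M -/N -/k -(bin_fact (leq_addl N k)) addnK !natrM; field.
  by rewrite !gt_eqF.
rewrite lnA; apply: (@le_trans _ _ (ln (laplace_ratio c * 'C(N + k, k)%:R))).
  by rewrite -ML ler_ln ?posrE // divr_gt0.
rewrite lnM ?posrE // lerD2l.
(* With a single state the binomial coefficient is 1 and the factor [k] removes the term containing
   a division by zero. *)
have [k0|k0] := posnP k; first by rewrite k0 bin0 ln1 mul0r.
have egt : 0 < expR 1 * (1 + N%:R / k%:R) :> R.
  by rewrite mulr_gt0 ?expR_gt0 // addr_gt0 // divr_gt0 // ltr0n.
rewrite [leRHS]mulr_natl -lnXn // ler_ln ?posrE ?exprn_gt0 //.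
exact: bin_le_expR.
Qed.

End LaplaceMixture.

(** * The uniform confidence event *)

Section GoodEvent.
Context {R : realType} {St Act : finType} {d : measure_display} {T : measurableType d}.
Context (P : probability T R) (F : nat -> set (set T)) (p : St -> Act -> St -> R).
Context (sa : nat -> T -> St * Act) (y : nat -> T -> St).
Hypothesis kernel_p : mdp_kernel p.

Lemma total_counts s a n w : total_count (counts sa y s a n w) = Ncount sa n w s a.
Proof.
rewrite /total_count /Ncount; under eq_bigr do rewrite ffunE.
rewrite exchange_big /=; apply: eq_bigr => t _.
rewrite (bigD1 (y t w)) //= eqxx andbT big1 ?addn0 // => z /negPf yz.
by rewrite [y t w == z]eq_sym yz andbF.
Qed.

Lemma phatE s a n w z : (0 < Ncount sa n w s a)%N ->
  phat R sa y n w s a z = (counts sa y s a n w z)%:R / (total_count (counts sa y s a n w))%:R.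
Proof. by rewrite lt0n /phat total_counts => /negPf ->; rewrite ffunE. Qed.

Lemma phat_simplex s a n w : (0 < Ncount sa n w s a)%N -> simplex (phat R sa y n w s a).
Proof.
move=> N0; split=> [z|]; first by rewrite phatE // divr_ge0.
under eq_bigr do rewrite phatE //.
rewrite -mulr_suml -natr_sum -/(total_count (counts sa y s a n w)) total_counts.
by rewrite divff // pnatr_eq0 -lt0n.
Qed.

(** A value below 1 excludes the default 1, hence gives absolute continuity, and bounds
    [laplace_ratio] by [S A / delta], whose logarithm is the first term of [xthr]. *)
Lemma KLball_of_ville_lt1 delta s a n w : 0 < delta -> (0 < #|Act|)%N ->
  ville_fun (p s a) (delta / (#|St|%:R * #|Act|%:R)) (counts sa y s a n w) < 1 ->
  KLball Act delta (phat R sa y n w s a) (Ncount sa n w s a) (p s a).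
Proof.
move=> d0 A0; have [p0 p1] := kernel_p s a.
have S0 : (0 < #|St|)%N by apply/card_gt0P; exists s.
have SA : 0 < #|St|%:R * #|Act|%:R :> R by rewrite mulr_gt0 ?ltr0n.
rewrite /ville_fun; case: ifPn => [ac|]; last by rewrite ltxx.
rewrite mulrC -ltr_pdivlMr ?divr_gt0 // div1r invf_div => hM.
split=> //; have [->|N0] := posnP (Ncount sa n w s a); [by left|right].
have acP z : 0 < phat R sa y n w s a z -> 0 < p s a z.
  rewrite phatE // => h; apply: (implyP (forallP ac z)); rewrite lt0n.
  by apply: contraTneq h => ->; rewrite mul0r ltxx.
rewrite /KL ifT; last by apply/forallP => z; apply/implyP; exact: acP.
rewrite -EFinM lee_fin mulr_sumr.
rewrite (eq_bigl (fun z => 0 < (counts sa y s a n w z)%:R /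
  (total_count (counts sa y s a n w))%:R :> R)); last by move=> z; rewrite phatE.
rewrite (eq_bigr (fun z => (counts sa y s a n w z)%:R * ln ((counts sa y s a n w z)%:R /
  (total_count (counts sa y s a n w))%:R / p s a z))); last first.
  by move=> z _; rewrite phatE // total_counts mulrA [_ * (_ / _)]mulrC divfK // pnatr_eq0 -lt0n.
rewrite /xthr -total_counts; apply: le_trans (kl_le_laplace_ratio _ _ _ ac) _ => //.
  by rewrite total_counts.
rewrite lerD2r ler_ln ?(ltW hM) // posrE; [exact: laplace_ratio_gt0|exact: divr_gt0].
Qed.

(** Union bound over the [S A] pairs, each failing with probability at most [delta / (S A)], the
    initial value of its supermartingale. *)
Lemma confidence_event delta : 0 < delta -> (0 < #|St|)%N -> (0 < #|Act|)%N ->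
  sampling_rule P F p sa y ->
  exists B : set T, [/\ measurable B, (P B <= delta%:E)%E &
    forall w, ~ B w -> forall n s a,
      KLball Act delta (phat R sa y n w s a) (Ncount sa n w s a) (p s a)].
Proof.
move=> d0 S0 A0 rule; set r := delta / (#|St|%:R * #|Act|%:R).
have r0 : 0 <= r by rewrite divr_ge0 ?mulr_ge0 // ltW.
have h (x : St * Act) : exists B : set T, [/\ measurable B,
    (forall w, ~ B w -> forall n, ville_fun (p x.1 x.2) r (counts sa y x.1 x.2 n w) < 1) &
    (P B <= r%:E)%E].
  have [p0 p1] := kernel_p x.1 x.2.
  rewrite -[X in X%:E](ville_fun0 (p x.1 x.2)).
  apply: (ville _ _ _ _ _ rule kernel_p) => c; first exact: ville_fun_ge0.
  exact: ville_fun_super.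
have [B hB] := choice h.
have mB x : measurable (B x) by have [] := hB x.
exists (\bigcup_x B x).
have mU : measurable (\bigcup_x B x) by apply: fin_bigcup_measurable => // x _.
split => //.
  apply: (le_trans (measure_le_sum_fin P _ B _ mU mB _)); first by move=> w [x _ ?]; exists x.
  apply: (@le_trans _ _ (\sum_(x : St * Act) r%:E)%E).
    by apply: lee_sum => x _; have [] := hB x.
  rewrite sumEFin lee_fin sumr_const card_prod -[_ *+ _]mulr_natr natrM divfK //.
  by rewrite mulf_neq0 // pnatr_eq0 -lt0n.
move=> w Bw n s a; apply: KLball_of_ville_lt1 => //.
have [_ /(_ w) hx _] := hB (s, a); apply: hx => Bx; apply: Bw.
by exists (s, a).
Qed.

End GoodEvent.

(** * From the stopping rule to near-optimality *)

Section Stopping.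
Context {R : realType} {St Act : finType} {d : measure_display} {T : measurableType d}.
Context (p : St -> Act -> St -> R) (rbar : St -> Act -> R).
Context (sa : nat -> T -> St * Act) (y : nat -> T -> St) (b : nat -> T -> St -> R).
Context (Ub Lb : bound_fun R St) (delta eps : R) (pihat : T -> St -> Act).
Hypothesis kernel_p : mdp_kernel p.
Hypothesis greedy : greedy_at_tau Ub Lb delta eps rbar sa y b pihat.

Lemma optgain_sub_gain_le w n : is_tau Ub Lb delta eps rbar sa y b w n ->
  (forall s a,
    ((dotp (p s a) (b n w))%:E <=
       Ub delta (phat R sa y n w s a) (Ncount sa n w s a) (b n w))%E /\
    (Lb delta (phat R sa y n w s a) (Ncount sa n w s a) (b n w) <=
       (dotp (p s a) (b n w))%:E)%E) ->
  forall s, optgain p rbar s - gain p rbar (pihat w) s <= eps.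
Proof.
move=> tau hUL s; pose D s a := rbar s a + dotp (p s a) (b n w) - b n w s.
have gap s1 a1 s2 : D s1 a1 - D s2 (pihat w s2) <= eps.
  have [stop _] := tau; rewrite -lee_fin EFinB; apply: le_trans stop.
  apply: leeB.
    have [hU _] := hUL s1 a1; rewrite /D EFinB EFinD.
    apply: (@le_trans _ _ (Isharp Ub delta rbar sa y b n w s1 a1)).
      by rewrite /Isharp leeB // leeD.
    apply: le_trans _ (le_bigmax -oo%E (fun s =>
      \big[maxe/-oo%E]_(a : Act) Isharp Ub delta rbar sa y b n w s a) s1).
    exact: (le_bigmax -oo%E (fun a => Isharp Ub delta rbar sa y b n w s1 a) a1).
  apply: (@le_trans _ _ (Iflat Lb delta rbar sa y b n w s2 (pihat w s2))).
    apply: le_trans (bigmin_le +oo%E s2 (fun s =>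
      \big[maxe/-oo%E]_(a : Act) Iflat Lb delta rbar sa y b n w s a)) _.
    (* Greediness makes the inner maximum at [s2] attained at [pihat w s2]. *)
    by apply/bigmax_leP; split => [|a _]; [exact: leNye|exact: greedy tau s2 a].
  by have [_ hL] := hUL s2 (pihat w s2); rewrite /D EFinB EFinD /Iflat leeB // leeD.
(* The drift of [pihat w] at its minimiser bounds the gain of [pihat w] from below; by [gap], the
   same number plus [eps] bounds every policy's gain from above. *)
pose s0 := [arg min_(z < s) D z (pihat w z)]%O.
have ge0 z : D s0 (pihat w s0) <= D z (pihat w z).
  by rewrite /s0; case: arg_minP => // i _; exact.
have low := gain_ge p rbar (pihat w) kernel_p (b n w) _ s ge0.
rewrite lerBlDr (@le_trans _ _ (eps + D s0 (pihat w s0))) ?lerD2l //.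
apply: ge_sup; first by exists (gain p rbar (pihat w) s), (pihat w).
move=> _ [pi _ <-]; apply: (gain_le _ _ _ kernel_p (b n w)) => z.
by rewrite -lerBlDr; exact: gap.
Qed.

End Stopping.

Theorem mainTheorem4 (R : realType) (St Act : finType)
  (p : St -> Act -> St -> R) (rbar : St -> Act -> R) (eps delta : R)
  (d : measure_display) (T : measurableType d) (P : probability T R)
  (F : nat -> set (set T)) (sa : nat -> T -> St * Act) (y : nat -> T -> St)
  (b : nat -> T -> St -> R) :
  (0 < #|St|)%N -> (0 < #|Act|)%N ->
  mdp_kernel p -> (forall s a, 0 <= rbar s a <= 1) ->
  weakly_communicating p ->
  0 < eps < 1 -> 0 < delta < 1 ->
  sampling_rule P F p sa y ->
  (forall pihat : T -> St -> Act,
     greedy_at_tau (@Ukl R St Act) (@Lkl R St Act) delta eps rbar sa y b pihat ->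
     prob_le P (bad_event (@Ukl R St Act) (@Lkl R St Act) delta eps rbar sa y b p pihat) delta)
  /\
  (forall pihat : T -> St -> Act,
     greedy_at_tau (@Utl R St Act) (@Ltl R St Act) delta eps rbar sa y b pihat ->
     prob_le P (bad_event (@Utl R St Act) (@Ltl R St Act) delta eps rbar sa y b p pihat) delta).
Proof.
move=> S0 A0 kernel_p _ _ _ /andP[d0 _] rule.
have [B [mB PB ball]] := confidence_event P F p sa y kernel_p delta d0 S0 A0 rule.
(* Both versions need only that the bounds bracket the true expectations outside the single event
   [B], which covers the bad event without any measurability of [b] or [pihat]. *)
have main Ub Lb pihat : greedy_at_tau Ub Lb delta eps rbar sa y b pihat ->
    (forall w n s a, ~ B w ->
      ((dotp (p s a) (b n w))%:E <=
         Ub delta (phat R sa y n w s a) (Ncount sa n w s a) (b n w))%E /\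
      (Lb delta (phat R sa y n w s a) (Ncount sa n w s a) (b n w) <=
         (dotp (p s a) (b n w))%:E)%E) ->
    prob_le P (bad_event Ub Lb delta eps rbar sa y b p pihat) delta.
  move=> greedy hUL; exists B; split => //; split => // w [[n tau] [s]].
  rewrite ltNge => /negP bad; apply: contrapT => Bw; apply: bad.
  by apply: (optgain_sub_gain_le _ _ _ _ _ _ _ _ _ _ kernel_p greedy _ _ tau) => s' a; exact: hUL.
split => pihat greedy; apply: (main _ _ _ greedy) => w n s a Bw; have hb := ball w Bw n s a.
  by split; [exact: Ukl_ge|exact: Lkl_le].
have hs : (0 < Ncount sa n w s a)%N -> simplex (phat R sa y n w s a) by exact: phat_simplex.
by split; [exact: Utl_ge|exact: Ltl_le].
Qed.
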